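(* Let $K\subset\mathbb{R}^n$ be an isotone projection cone, let $\bar x\in\mathbb{R}^n$ and $\bar y=P_K(\bar x)$. Then the covering constant $\widehat\alpha(P_K,\bar x,\bar y)$ of the metric projection $P_K$ satisfies: (i) $\widehat\alpha(P_K,\bar x,\bar y)=1$ for all $\bar x\in\operatorname{int}K$; (ii) $\widehat\alpha(P_K,\bar x,\bar y)=0$ for all $\bar x\notin\operatorname{int}K$.
   Context: $n\ge1$. $P_K$ denotes the Euclidean metric projection onto $K$. A closed generating (convex, pointed) cone $K\subset\mathbb{R}^n$ is an isotone projection cone if for all $x,y\in\mathbb{R}^n$ with $y-x\in K$ one has $P_K(y)-P_K(x)\in K$. It is known that $K$ is an isotone projection cone if and only if $K=\{\sum_{i=1}^n\alpha_i b_i\mid\alpha_i\ge0\}$ for some linearly independent $b_1,\ldots,b_n\in\mathbb{R}^n$ whose associated vectors $u_1,\ldots,u_n$, determined by $\langle u_j,b_i\rangle=-\delta_{ij}$ (Kronecker delta), satisfy $\langle u_j,u_k\rangle\le0$ for all $j\ne k$. Fréchet normal cone of $\Omega$ at $\bar w\in\Omega$: $\widehat N_\Omega(\bar w)=\{z\mid\limsup_{w\to\bar w,\,w\in\Omega}\langle z,w-\bar w\rangle/\|w-\bar w\|\le0\}$. Fréchet coderivative of a set-valued map $\Phi$ at $(x,y)\in\operatorname{gph}\Phi$: $\widehat D^*\Phi(x,y)(w)=\{v\mid(v,-w)\in\widehat N_{\operatorname{gph}\Phi}(x,y)\}$. With $\mathbb{B}(x,r)$ the closed ball, the covering constant of $\Phi$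 at $(\bar x,\bar y)\in\operatorname{gph}\Phi$ is $$\widehat\alpha(\Phi,\bar x,\bar y):=\sup_{\eta>0}\inf\{\|z^*\|\mid z^*\in\widehat D^*\Phi(x,y)(w^* ),\ x\in\mathbb{B}(\bar x,\eta),\ y\in\Phi(x)\cap\mathbb{B}(\bar y,\eta),\ \|w^*\|=1\}.$$ The single-valued map $P_K$ is regarded as the set-valued map $x\mapsto\{P_K(x)\}$. *)

(* Defs.v *)
From HB Require Import structures.
From mathcomp Require Import all_boot all_order all_algebra.
From mathcomp Require Import all_classical all_reals all_analysis.

Set Implicit Arguments.
Unset Strict Implicit.
Unset Printing Implicit Defensive.

Import Order.TTheory GRing.Theory Num.Theory.
Import numFieldNormedType.Exports.

Local Open Scope classical_set_scope.
Local Open Scope ring_scope.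

(* The library norm on 'rV[R]_n is the sup norm, hence the explicit Euclidean
   structure below.  Its topology is the library's topology on 'rV[R]_n, so
   closed, interior and punctured neighbourhoods are the library's own. *)
Definition dotv (R : realType) (n : nat) (u v : 'rV[R]_n) : R :=
  \sum_(i < n) u 0 i * v 0 i.

Definition enorm (R : realType) (n : nat) (u : 'rV[R]_n) : R :=
  Num.sqrt (dotv u u).

Definition eball (R : realType) (n : nat) (c : 'rV[R]_n) (r : R) :
    set 'rV[R]_n :=
  [set x | enorm (x - c) <= r].

Definition is_nearest_point (R : realType) (n : nat) (K : set 'rV[R]_n)
    (x p : 'rV[R]_n) : Prop :=
  K p /\ forall q, K q -> enorm (x - p) <= enorm (x - q).

(* get P is some element of P; a nonempty closed convex K has exactly one
   nearest point to each x. *)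
Definition metric_proj (R : realType) (n : nat) (K : set 'rV[R]_n)
    (x : 'rV[R]_n) : 'rV[R]_n :=
  get [set p | is_nearest_point K x p].

Record closed_generating_pointed_cone (R : realType) (n : nat)
    (K : set 'rV[R]_n) : Prop := ClosedGeneratingPointedCone {
  cone_nonempty : K !=set0;
  cone_scale : forall (t : R) x, 0 <= t -> K x -> K (t *: x);
  cone_convex : @convex_set R (convex_lmodType 'rV[R]_n) K;
  cone_closed : closed K;
  cone_pointed : forall x, K x -> K (- x) -> x = 0;
  cone_generating : forall x, exists u v, [/\ K u, K v & x = u - v] }.

Definition isotone_projection_cone (R : realType) (n : nat)
    (K : set 'rV[R]_n) : Prop :=
  closed_generating_pointed_cone K /\
  forall x y, K (y - x) -> K (metric_proj K y - metric_proj K x).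

(* R^n x R^m is represented by 'rV[R]_(n + m) through row_mx, so that dotv and
   enorm on it are the Euclidean product structure. *)
Definition gph (R : realType) (n m : nat) (Phi : 'rV[R]_n -> set 'rV[R]_m) :
    set 'rV[R]_(n + m) :=
  [set row_mx p.1 p.2 | p in [set p : 'rV[R]_n * 'rV[R]_m | Phi p.1 p.2]].

Definition frechet_normal_cone (R : realType) (n : nat) (Omega : set 'rV[R]_n)
    (wbar : 'rV[R]_n) : set 'rV[R]_n :=
  [set z | (limf_esup
              (fun w : 'rV[R]_n => (dotv z (w - wbar) / enorm (w - wbar))%:E)
              (within Omega (dnbhs wbar)) <= 0)%E].

Definition frechet_coderivative (R : realType) (n m : nat)
    (Phi : 'rV[R]_n -> set 'rV[R]_m) (x : 'rV[R]_n) (y : 'rV[R]_m)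
    (w : 'rV[R]_m) : set 'rV[R]_n :=
  [set v | frechet_normal_cone (gph Phi) (row_mx x y) (row_mx v (- w))].

(* The infimum and supremum are taken in \bar R; inf of the empty set is +oo. *)
Definition covering_constant (R : realType) (n m : nat)
    (Phi : 'rV[R]_n -> set 'rV[R]_m) (xbar : 'rV[R]_n) (ybar : 'rV[R]_m) :
    \bar R :=
  ereal_sup [set ereal_inf [set (enorm zs)%:E | zs in
      [set zs : 'rV[R]_n | exists (x : 'rV[R]_n) (y ws : 'rV[R]_m),
         [/\ eball xbar eta x, Phi x y, eball ybar eta y,
             enorm ws = 1 & frechet_coderivative Phi x y ws zs]]]
    | eta in [set eta : R | 0 < eta]].

(* Main.v *)
Require Import Defs.
From HB Require Import structures.
From mathcomp Require Import all_boot all_order all_algebra.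
From mathcomp Require Import all_classical all_reals all_analysis.
From mathcomp Require Import ring lra.

Set Implicit Arguments.
Unset Strict Implicit.
Unset Printing Implicit Defensive.

Import Order.TTheory GRing.Theory Num.Theory.
Import numFieldNormedType.Exports.

Local Open Scope classical_set_scope.
Local Open Scope ring_scope.

(** Only the closedness and convexity of [K] matter. Near an interior point
[P_K] is the identity, whose coderivative is the identity. If [xbar] is not
interior, there are points [x] outside [K] arbitrarily close to [xbar]; with
[p = P_K x], the variational inequality [<x - p, q - p> <= 0] at
[q = P_K x'] says exactly that [0] is in the coderivative of [P_K] at [x] in
the unit direction [(p - x) / |p - x|]. Nonexpansiveness keeps [p] close to
[P_K xbar], so the infimum over every ball is [0]. *)

(** * Euclidean inner product and norm *)

Lemma dotvC (R : realType) (n : nat) (u v : 'rV[R]_n) : dotv u v = dotv v u.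
Proof. by apply: eq_bigr => i _; rewrite mulrC. Qed.

Lemma dotvDl (R : realType) (n : nat) (u v w : 'rV[R]_n) :
  dotv (u + v) w = dotv u w + dotv v w.
Proof. by rewrite -big_split; apply: eq_bigr => i _; rewrite mxE mulrDl. Qed.

Lemma dotvZl (R : realType) (n : nat) (a : R) (u w : 'rV[R]_n) :
  dotv (a *: u) w = a * dotv u w.
Proof. by rewrite mulr_sumr; apply: eq_bigr => i _; rewrite mxE mulrA. Qed.

Lemma dotv0l (R : realType) (n : nat) (w : 'rV[R]_n) : dotv 0 w = 0.
Proof. by rewrite -(scale0r 0) dotvZl mul0r. Qed.

Lemma dotvDr (R : realType) (n : nat) (u v w : 'rV[R]_n) :
  dotv w (u + v) = dotv w u + dotv w v.
Proof. by rewrite dotvC dotvDl !(dotvC w). Qed.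

Lemma dotvZr (R : realType) (n : nat) (a : R) (u w : 'rV[R]_n) :
  dotv w (a *: u) = a * dotv w u.
Proof. by rewrite dotvC dotvZl dotvC. Qed.

Lemma dotvNl (R : realType) (n : nat) (u w : 'rV[R]_n) :
  dotv (- u) w = - dotv u w.
Proof. by rewrite -scaleN1r dotvZl mulN1r. Qed.

Lemma dotvNr (R : realType) (n : nat) (u w : 'rV[R]_n) :
  dotv w (- u) = - dotv w u.
Proof. by rewrite dotvC dotvNl dotvC. Qed.

Definition dotvE := (dotvDl, dotvDr, dotvNl, dotvNr, dotvZl, dotvZr).

Lemma dotv_row_mx (R : realType) (n m : nat) (a c : 'rV[R]_n) (b d : 'rV[R]_m) :
  dotv (row_mx a b) (row_mx c d) = dotv a c + dotv b d.
Proof.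
rewrite /dotv big_split_ord /=.
by congr (_ + _); apply: eq_bigr => i _; rewrite ?row_mxEl ?row_mxEr.
Qed.

Lemma dotvv_ge0 (R : realType) (n : nat) (u : 'rV[R]_n) : 0 <= dotv u u.
Proof. by apply: sumr_ge0 => i _; rewrite -expr2 sqr_ge0. Qed.

Lemma coord_le_enorm (R : realType) (n : nat) (u : 'rV[R]_n) (i : 'I_n) :
  `|u 0 i| <= enorm u.
Proof.
rewrite -sqrtr_sqr ler_wsqrtr// /dotv (bigD1 i)//= -expr2 lerDl.
by apply: sumr_ge0 => j _; rewrite -expr2 sqr_ge0.
Qed.

(** Links the library's sup norm to the Euclidean one; definiteness of [dotv] and the comparison of
    balls both rest on it. *)
Lemma norm_le_enorm (R : realType) (n : nat) (u : 'rV[R]_n) : `|u| <= enorm u.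
Proof.
rewrite [leLHS]/Num.norm/= mx_normrE; apply/bigmax_leP; split.
  exact: sqrtr_ge0.
by move=> [i j] _ /=; rewrite ord1 coord_le_enorm.
Qed.

Lemma dotvv_eq0 (R : realType) (n : nat) (u : 'rV[R]_n) :
  (dotv u u == 0) = (u == 0).
Proof.
apply/eqP/eqP => [u0|->]; last exact: dotv0l.
apply/eqP; rewrite -normr_le0; apply: le_trans (norm_le_enorm u) _.
by rewrite /enorm u0 sqrtr0.
Qed.

Lemma enorm_le (R : realType) (n m : nat) (u : 'rV[R]_n) (v : 'rV[R]_m) :
  (enorm u <= enorm v) = (dotv u u <= dotv v v).
Proof. by rewrite ler_sqrt// dotvv_ge0. Qed.

Lemma enorm_gt0 (R : realType) (n : nat) (u : 'rV[R]_n) :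
  (0 < enorm u) = (u != 0).
Proof. by rewrite sqrtr_gt0 lt_def dotvv_ge0 andbT dotvv_eq0. Qed.

Lemma enormZ (R : realType) (n : nat) (a : R) (u : 'rV[R]_n) :
  enorm (a *: u) = `|a| * enorm u.
Proof.
by rewrite /enorm dotvZl dotvZr mulrA -expr2 sqrtrM ?sqr_ge0// sqrtr_sqr.
Qed.

Lemma enorm0 (R : realType) (n : nat) : enorm (0 : 'rV[R]_n) = 0.
Proof. by rewrite -(scale0r 0) enormZ normr0 mul0r. Qed.

Lemma enorm_distrC (R : realType) (n : nat) (u v : 'rV[R]_n) :
  enorm (u - v) = enorm (v - u).
Proof. by rewrite -opprB -scaleN1r enormZ normrN1 mul1r. Qed.

Lemma enorm_normalize (R : realType) (n : nat) (u : 'rV[R]_n) :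
  u != 0 -> enorm ((enorm u)^-1 *: u) = 1.
Proof.
rewrite -enorm_gt0 => u0.
by rewrite enormZ gtr0_norm ?invr_gt0// mulVf// gt_eqF.
Qed.

(** * Euclidean balls and the library topology *)

Lemma enorm_sub_continuous (R : realType) (n : nat) (x : 'rV[R]_n) :
  continuous (fun y : 'rV[R]_n => enorm (y - x)).
Proof.
have dotv_cont : continuous (fun z : 'rV[R]_n => dotv (z - x) (z - x)).
  apply: continuous_big => [|i _ z]; first exact: add_continuous.
  have coord : {for z, continuous (fun w : 'rV[R]_n => (w - x) 0 i)}.
    rewrite [X in {for _, continuous X}](_ : _ =
        (fun w : 'rV[R]_n => w 0 i) - cst (x 0 i)); last first.
      by apply/funext => w; rewrite !mxE.
    by apply: continuousB; [exact: coord_continuous|exact: cst_continuous].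
  exact: (continuousM coord coord).
move=> y; rewrite /enorm; apply: (continuous_comp (dotv_cont y)).
exact: sqrt_continuous.
Qed.

Lemma nbhs_eball (R : realType) (n : nat) (c : 'rV[R]_n) (r : R) :
  0 < r -> nbhs c (eball c r).
Proof.
move=> r0; have := @enorm_sub_continuous R n c c => /cvgr_le; apply.
by rewrite subrr enorm0.
Qed.

Lemma eball_subset (R : realType) (n : nat) (c : 'rV[R]_n) (A : set 'rV[R]_n) :
  nbhs c A -> exists2 r, 0 < r & eball c r `<=` A.
Proof.
(* Halving passes from the closed ball [eball] to the open sup-norm ball. *)
move=> /nbhs_ballP[e /= e0 ceA]; exists (e / 2); first by rewrite divr_gt0.
move=> x cx; apply: ceA; rewrite -ball_normE /ball_/= distrC.
apply: le_lt_trans (norm_le_enorm _) (le_lt_trans cx _).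
by rewrite ltr_pdivrMr// ltr_pMr// ltr1n.
Qed.

(** * Metric projection onto a closed convex set *)

Lemma exists_nearest_point (R : realType) (n : nat) (K : set 'rV[R]_n)
    (x : 'rV[R]_n) :
  closed K -> K !=set0 -> exists p, is_nearest_point K x p.
Proof.
(* Only points at least as close to [x] as [q0] compete; they form a compact set, on which the
   continuous distance attains its minimum. *)
move=> cK [q0 Kq0]; pose A := K `&` eball x (enorm (q0 - x)).
have cA : closed A.
  apply: closedI => //; apply: (@preimage_closed 'rV[R]_n R
    (fun y => enorm (y - x)) [set r | r <= enorm (q0 - x)]).
    by move=> y _; exact: enorm_sub_continuous.
  exact: closed_le.
have bA : bounded_set A.
  exists (enorm (q0 - x) + `|x|); split; first exact: num_real.
  move=> M /ltW xM y [_ xy] /=; apply: le_trans xM.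
  rewrite -[X in `|X|](subrK x) (le_trans (ler_normD _ _))// lerD2r.
  exact: le_trans (norm_le_enorm _) xy.
have A0 : A !=set0 by exists q0; split => //; exact: lexx.
have fA : {within A, continuous (fun y => enorm (y - x))}.
  exact/continuous_subspaceT/enorm_sub_continuous.
have [p] := EVT_min_rV A0 (bounded_closed_compact bA cA) fA.
rewrite inE => -[Kp xp] pmin; exists p; split => // q Kq.
rewrite !(enorm_distrC x).
have [qA|/ltW qA] := leP (enorm (q - x)) (enorm (q0 - x)).
  by apply: pmin; rewrite inE.
exact: le_trans xp qA.
Qed.

Lemma metric_proj_nearest (R : realType) (n : nat) (K : set 'rV[R]_n)
    (x : 'rV[R]_n) :
  closed K -> K !=set0 -> is_nearest_point K x (metric_proj K x).
Proof.
by move=> cK K0; have [p pP] := exists_nearest_point x cK K0; exact: getI pP.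
Qed.

(** Minimality tested against [x] itself forces distance zero, so whichever nearest point [get]
    selects must be [x]. *)
Lemma metric_proj_id (R : realType) (n : nat) (K : set 'rV[R]_n)
    (x : 'rV[R]_n) :
  K x -> metric_proj K x = x.
Proof.
move=> Kx; have /getI[_ /(_ x Kx)] : is_nearest_point K x x.
  by split => // q _; rewrite subrr enorm0 sqrtr_ge0.
rewrite subrr enorm_le dotv0l => xp; apply/esym/eqP.
by rewrite -subr_eq0 -dotvv_eq0 eq_le xp dotvv_ge0.
Qed.

Lemma convex_set_segment (R : realType) (n : nat) (K : set 'rV[R]_n)
    (p q : 'rV[R]_n) (t : R) :
  @convex_set R (convex_lmodType 'rV[R]_n) K -> K p -> K q ->
  0 <= t <= 1 -> K (p + t *: (q - p)).
Proof.
move=> cK Kp Kq /andP[t0 t1].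
have := cK q p (Itv01 t0 t1); rewrite !inE => /(_ Kq Kp).
by rewrite /conv/= /unstable.onem scalerBl scale1r scalerBr addrCA.
Qed.

(** Otherwise a short move from [p] towards [q] stays in [K] and gets strictly closer to [x]. *)
Lemma nearest_point_variational (R : realType) (n : nat) (K : set 'rV[R]_n)
    (x p q : 'rV[R]_n) :
  @convex_set R (convex_lmodType 'rV[R]_n) K ->
  is_nearest_point K x p -> K q -> dotv (x - p) (q - p) <= 0.
Proof.
move=> cK [Kp pmin] Kq; rewrite leNgt; apply/negP => c0.
pose c := dotv (x - p) (q - p); pose d := dotv (q - p) (q - p).
have d0 : 0 <= d by exact: dotvv_ge0.
have cd0 : 0 < c + d by rewrite ltr_wpDr.
(* The squared distance changes by [- 2 * t * c + t * (t * d)]. This [t] is at most 1 and gives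
   [t * d <= c], so the change is at most [- t * c < 0]. *)
pose t := c / (c + d).
have t0 : 0 < t by rewrite divr_gt0.
have t1 : t <= 1 by rewrite ler_pdivrMr// mul1r lerDl.
have /pmin : K (p + t *: (q - p)).
  by apply: convex_set_segment => //; rewrite t1 ltW.
rewrite enorm_le opprD addrA.
rewrite [leRHS](_ : _ = dotv (x - p) (x - p) - 2 * t * c + t * (t * d)).
  have td : t * d <= c.
    by rewrite mulrAC ler_pdivrMr// mulrDr lerDr mulr_ge0// ltW.
  have := ler_wpM2l (ltW t0) td; have := mulr_gt0 t0 c0; rewrite -/c; lra.
rewrite /c /d; move: (x - p) (q - p) => v h.
by rewrite !dotvE (dotvC h v); ring.
Qed.

Lemma metric_proj_nonexpansive (R : realType) (n : nat) (K : set 'rV[R]_n)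
    (x y : 'rV[R]_n) :
  closed K -> K !=set0 -> @convex_set R (convex_lmodType 'rV[R]_n) K ->
  enorm (metric_proj K x - metric_proj K y) <= enorm (x - y).
Proof.
move=> clK K0 cK.
have xP := metric_proj_nearest x clK K0.
have yP := metric_proj_nearest y clK K0.
have := nearest_point_variational cK xP yP.1.
have := nearest_point_variational cK yP xP.1.
move: (metric_proj K x) (metric_proj K y) => p q h1 h2.
rewrite enorm_le.
have := dotvv_ge0 ((x - y) - (p - q)).
(* Sum of the two variational inequalities. With [a = x - y] and [b = p - q], expanding the square
   of [(a - b) + b] then bounds the square of [b] by that of [a]. *)
have : 0 <= dotv ((x - y) - (p - q)) (p - q).
  move: h1 h2; rewrite !dotvE; lra.
move: (x - y) (p - q) => a b; rewrite !dotvE (dotvC b a); lra.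
Qed.

(** * Criteria for Fréchet normals *)

Lemma frechet_normal_cone_near (R : realType) (n : nat) (Omega : set 'rV[R]_n)
    (w z : 'rV[R]_n) :
  (\forall w' \near w, Omega w' -> dotv z (w' - w) <= 0) ->
  frechet_normal_cone Omega w z.
Proof.
(* The upper limit is an infimum of suprema over sets of the filter, so one set suffices: by [zw]
   this half-space is such a set. *)
move=> zw; pose V := [set w' | dotv z (w' - w) <= 0].
apply: (@le_trans _ _ (ereal_sup
    [set (dotv z (w' - w) / enorm (w' - w))%:E | w' in V])).
  apply: ereal_inf_lbound; exists V => //.
  by rewrite /within/=; apply: filterS zw => w' zw' _; exact: zw'.
apply: ge_ereal_sup => _ [w' zw' <-]; rewrite lee_fin.
by rewrite mulr_le0_ge0// invr_ge0 sqrtr_ge0.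
Qed.

Lemma ray_cvg (R : realType) (n : nat) (w d : 'rV[R]_n) :
  w + t *: d @[t --> 0^'+] --> w.
Proof.
rewrite -[X in _ --> X]addr0 -(scale0r d); apply: cvgD; first exact: cvg_cst.
by apply: cvgZr_tmp; exact: cvg_within.
Qed.

(** Along the ray the difference quotient is constantly [dotv z d / enorm d], which therefore bounds
    the upper limit from below. *)
Lemma frechet_normal_cone_dir (R : realType) (n : nat) (Omega : set 'rV[R]_n)
    (w z d : 'rV[R]_n) :
  (\forall t \near 0^'+, Omega (w + t *: d)) ->
  frechet_normal_cone Omega w z -> dotv z d <= 0.
Proof.
move=> Od; apply: contraPP => /negP; rewrite -ltNge => zd0.
have d0 : d != 0.
  by apply: contraTneq zd0 => ->; rewrite dotvC dotv0l ltxx.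
have ed0 : 0 < enorm d by rewrite enorm_gt0.
rewrite /frechet_normal_cone/=; apply/negP; rewrite -ltNge.
apply: (@lt_le_trans _ _ (dotv z d / enorm d)%:E).
  by rewrite lte_fin divr_gt0.
apply: le_ereal_inf_tmp => _ [V wV <-].
have /(filterI Od) : \forall t \near 0^'+,
    w + t *: d != w -> Omega (w + t *: d) -> V (w + t *: d).
  by apply: (@ray_cvg R n w d [set y | y != w -> Omega y -> V y]); exact: wV.
move=> /(filterI (nbhs_right_gt 0)) /filter_ex[t [/= t0 [Ot Vt]]].
apply: ereal_sup_ubound; exists (w + t *: d).
  by apply: Vt => //; rewrite -subr_eq0 addrC addKr scaler_eq0 negb_or gt_eqF.
rewrite addrC addKr dotvZr enormZ gtr0_norm// invfM mulrACA divff ?mul1r//.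
by rewrite gt_eqF.
Qed.

(** * Coderivatives of the projection *)

Lemma metric_proj_coderivative_interior (R : realType) (n : nat)
    (K : set 'rV[R]_n) (x ws zs : 'rV[R]_n) :
  interior K x ->
  frechet_coderivative (fun x => [set metric_proj K x]) x x ws zs <-> zs = ws.
Proof.
move=> Kx; split=> [|->].
  (* Near [(x, x)] the graph is the diagonal, which contains this direction; pairing it with
     [(zs, - ws)] gives the squared norm of [zs - ws]. *)
  have ray_gph : \forall t \near 0^'+, gph (fun x => [set metric_proj K x])
      (row_mx x x + t *: row_mx (zs - ws) (zs - ws)).
    have Kray : \forall t \near 0^'+, K (x + t *: (zs - ws)).
      by apply: (@ray_cvg R n x (zs - ws) K).
    apply: filterS Kray => t Kt.
    exists (x + t *: (zs - ws), x + t *: (zs - ws)) => /=.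
      by rewrite metric_proj_id.
    by rewrite scale_row_mx add_row_mx.
  move=> /(frechet_normal_cone_dir ray_gph).
  rewrite dotv_row_mx -dotvDl => zw.
  by apply/eqP; rewrite -subr_eq0 -dotvv_eq0 eq_le zw dotvv_ge0.
apply: frechet_normal_cone_near.
have /nbhs_ballP[e /= e0 xK] := Kx.
apply/nbhs_ballP; exists e => //= w' [_ xw'] [[a b] /= ab w'E].
have Ka : K a.
  apply: xK; split=> // i j; have := xw' i (lshift n j).
  by rewrite -w'E !row_mxEl.
rewrite -w'E ab metric_proj_id// opp_row_mx add_row_mx dotv_row_mx dotvNl.
by rewrite subrr.
Qed.

(** The variational inequality holds against every point of the graph, so the radius 1 below is
    arbitrary. If [p = x], the direction is the zero vector. *)
Lemma metric_proj_coderivative_residual (R : realType) (n : nat)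
    (K : set 'rV[R]_n) (x : 'rV[R]_n) (p := metric_proj K x) :
  closed K -> K !=set0 -> @convex_set R (convex_lmodType 'rV[R]_n) K ->
  frechet_coderivative (fun x => [set metric_proj K x]) x p
    ((enorm (p - x))^-1 *: (p - x)) 0.
Proof.
move=> clK K0 cK; apply: frechet_normal_cone_near.
apply/nbhs_ballP; exists 1 => //= _ _ [[a b] /= -> <-].
rewrite opp_row_mx add_row_mx dotv_row_mx dotv0l add0r dotvNl -dotvNr.
rewrite dotvZl mulr_ge0_le0 ?invr_ge0 ?sqrtr_ge0//.
rewrite -[p - x]opprB dotvNl dotvNr opprK.
exact: (nearest_point_variational cK (metric_proj_nearest x clK K0)
  (metric_proj_nearest a clK K0).1).
Qed.

(** * Values of the covering constant *)

Definition coderivative_norms (R : realType) (n m : nat)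
    (Phi : 'rV[R]_n -> set 'rV[R]_m) (xbar : 'rV[R]_n) (ybar : 'rV[R]_m)
    (eta : R) : set (\bar R) :=
  [set (enorm zs)%:E | zs in
      [set zs : 'rV[R]_n | exists (x : 'rV[R]_n) (y ws : 'rV[R]_m),
         [/\ eball xbar eta x, Phi x y, eball ybar eta y,
             enorm ws = 1 & frechet_coderivative Phi x y ws zs]]].

Lemma covering_constantE (R : realType) (n m : nat)
    (Phi : 'rV[R]_n -> set 'rV[R]_m) (xbar : 'rV[R]_n) (ybar : 'rV[R]_m) :
  covering_constant Phi xbar ybar =
  ereal_sup [set ereal_inf (coderivative_norms Phi xbar ybar eta)
            | eta in [set eta : R | 0 < eta]].
Proof. by []. Qed.

Lemma covering_constant_interior (R : realType) (n : nat) (K : set 'rV[R]_n)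
    (x : 'rV[R]_n) :
  (0 < n)%N -> interior K x ->
  covering_constant (fun x => [set metric_proj K x]) x x = 1%E.
Proof.
move=> n0 Kx; rewrite covering_constantE.
apply/eqP; rewrite eq_le; apply/andP; split.
  apply: ge_ereal_sup => _ [eta /= eta0 <-].
  apply: ereal_inf_lbound.
  (* Since [0 < n], the all-ones vector is nonzero; normalized, it is its own coderivative value at
     [x], so every infimum is at most 1. *)
  pose e : 'rV[R]_n := const_mx 1.
  have e0 : e != 0.
    apply/eqP => /rowP/(_ (Ordinal n0)); rewrite !mxE => /eqP.
    by rewrite oner_eq0.
  have e1 := enorm_normalize e0.
  exists ((enorm e)^-1 *: e); last by rewrite e1.
  exists x, x, ((enorm e)^-1 *: e); split => //.
  - by rewrite /eball/= subrr enorm0 ltW.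
  - by rewrite metric_proj_id//; exact: interior_subset Kx.
  - by rewrite /eball/= subrr enorm0 ltW.
  - exact/metric_proj_coderivative_interior.
(* On this ball every coderivative is the identity, so all the norms equal 1 and one radius gives
   the lower bound. *)
have [eta eta0 xK] : exists2 eta, 0 < eta & eball x eta `<=` interior K.
  by apply: eball_subset; exact: open_nbhs_nbhs (conj (open_interior K) Kx).
apply: (@le_trans _ _ (ereal_inf
    (coderivative_norms (fun x => [set metric_proj K x]) x x eta))); last first.
  by apply: ereal_sup_ubound; exists eta.
apply: le_ereal_inf_tmp => _ [zs [a [b [ws [/xK Ka -> _ ws1 +]]]] <-].
rewrite metric_proj_id; last exact: interior_subset.
by move/(metric_proj_coderivative_interior _ _ Ka) => ->; rewrite ws1.
Qed.

Lemma covering_constant_not_interior (R : realType) (n : nat) (K : set 'rV[R]_n)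
    (x : 'rV[R]_n) :
  closed K -> K !=set0 -> @convex_set R (convex_lmodType 'rV[R]_n) K ->
  ~ interior K x ->
  covering_constant (fun x => [set metric_proj K x]) x (metric_proj K x) = 0%E.
Proof.
move=> clK K0 cK nKx; rewrite covering_constantE -[RHS]ereal_sup1.
congr ereal_sup.
(* The family of infima is constantly 0; since some positive radius exists, its set of values is
   exactly the singleton 0. *)
suff inf0 eta : 0 < eta -> ereal_inf (coderivative_norms
    (fun x => [set metric_proj K x]) x (metric_proj K x) eta) = 0%E.
  apply/seteqP; split=> [_ [eta /= eta0 <-]|_ ->]; first exact: inf0.
  by exists 1; [exact: ltr01|exact: inf0].
move=> eta0; apply/eqP; rewrite eq_le; apply/andP; split; last first.
  by apply: le_ereal_inf_tmp => _ [zs _ <-]; rewrite lee_fin sqrtr_ge0.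
(* A ball contained in [K] would make [x] interior. *)
have [a xa nKa] : exists2 a, eball x eta a & ~ K a.
  apply: contrapT => noa; apply: nKx.
  apply: filterS (nbhs_eball x eta0) => a xa.
  by apply: contrapT => nKa; apply: noa; exists a.
apply: ereal_inf_lbound; exists 0; last by rewrite enorm0.
exists a, (metric_proj K a).
exists ((enorm (metric_proj K a - a))^-1 *: (metric_proj K a - a)); split => //.
- exact: le_trans (metric_proj_nonexpansive a x clK K0 cK) xa.
(* The residual at [a] is nonzero because its projection lies in [K] and [a] does not. *)
- apply: enorm_normalize; rewrite subr_eq0; apply/eqP => pa; apply: nKa.
  by rewrite -pa; exact: (metric_proj_nearest a clK K0).1.
- exact: metric_proj_coderivative_residual.
Qed.

Theorem theorem4p2 (R : realType) (n : nat) (n_gt0 : (0 < n)%N)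
    (K : set 'rV[R]_n) (HK : isotone_projection_cone K)
    (xbar ybar : 'rV[R]_n) (Hybar : ybar = metric_proj K xbar) :
  (interior K xbar ->
     covering_constant (fun x => [set metric_proj K x]) xbar ybar = 1%E) /\
  (~ interior K xbar ->
     covering_constant (fun x => [set metric_proj K x]) xbar ybar = 0%E).
Proof.
case: HK => -[K0 _ cK clK _ _] _; rewrite Hybar; split => [Kx|nKx].
  rewrite metric_proj_id; last exact: interior_subset.
  exact: covering_constant_interior.
exact: covering_constant_not_interior.
Qed.
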